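(* For all integers $a,b\ge2$ and every integer $k\ge0$, $HP^k(\Lambda(a,b))\cong HP_k(\Lambda(a,b),M_\nu)$ as complex vector spaces.
   Context: For integers $a,b\geq 2$, $\Lambda(a,b):=\mathbb C[X,Y]/(X^a,Y^b)$ with basis $X^iY^j$ ($0\le i\le a-1$, $0\le j\le b-1$) and Poisson bracket determined by $\{X,Y\}=XY$; equivalently $\{X^iY^j,X\}=-jX^{i+1}Y^j$, $\{X^iY^j,Y\}=iX^iY^{j+1}$. $HP^k(\Lambda(a,b))$ is the $k$-th cohomology of the complex $\chi^k$ of skew-symmetric $k$-derivations with Poisson coboundary $\delta_k(P)(f_0,\dots,f_k)=\sum_{i}(-1)^i\{f_i,P(\dots\widehat{f_i}\dots)\}+\sum_{i<j}(-1)^{i+j}P(\{f_i,f_j\},\dots\widehat{f_i}\dots\widehat{f_j}\dots)$. $M_\nu$ is $\Lambda(a,b)$ as a module with external bracket $\{X^iY^j,X\}_{M_\nu}=-(j-b+1)X^{i+1}Y^j$, $\{X^iY^j,Y\}_{M_\nu}=(i-a+1)X^iY^{j+1}$ (extended linearly in the first argument and by $\{m,fg\}_{M_\nu}=\{m,f\}_{M_\nu}g+\{m,g\}_{M_\nu}f$ in the second). $HP_k(\Lambda(a,b),M)$ is the homology of $M\otimes_{\Lambda(a,b)}\Omega^k$, where $\Omega^0=\Lambda(a,b)$, $\Omega^1=(\Lambda(a,b)dX\oplus\Lambda(a,b)dY)/(X^{a-1}dX,Y^{b-1}dY)$, $\Omega^2=\Lambda(a,b)\,dX\wedge dY/(X^{a-1},Y^{b-1})$,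 $\Omega^k=0$ for $k\ge3$, with boundary $\partial_1(m\otimes dX)=\{m,X\}_M$, $\partial_1(m\otimes dY)=\{m,Y\}_M$, $\partial_2(m\otimes dX\wedge dY)=\{m,X\}_M\otimes dY-\{m,Y\}_M\otimes dX-(mX\otimes dY+mY\otimes dX)$. *)

(* Defs.v *)
From HB Require Import structures.
From mathcomp Require Import all_boot all_order all_algebra.
From mathcomp Require Import fingroup perm.
Set Implicit Arguments. Unset Strict Implicit. Unset Printing Implicit Defensive.
Import GRing.Theory Num.Theory.
Local Open Scope ring_scope.

(* Coefficient field: an arbitrary numClosedFieldType (e.g. algC), the
   MathComp abstraction of the complex numbers. *)
Section Lambda.
Variables (F : numClosedFieldType) (a b : nat).

(* Index set of the monomial basis X^i Y^j, 0 <= i < a, 0 <= j < b. *)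
Definition Bidx := ('I_a * 'I_b)%type.

(* Lambda(a,b) (and also the underlying space of M_nu): coordinates in the
   basis X^i Y^j. *)
Definition Lam := {ffun Bidx -> F^o}.

(* The monomial X^n Y^l (zero if n >= a or l >= b). *)
Definition mono (n l : nat) : Lam :=
  [ffun p : Bidx => ((p.1 == n :> nat) && (p.2 == l :> nat))%:R].

Definition bas (p : Bidx) : Lam := mono p.1 p.2.

(* Multiplication of C[X,Y]/(X^a,Y^b). *)
Definition mulL (f g : Lam) : Lam :=
  [ffun p : Bidx => \sum_(q : Bidx) \sum_(r : Bidx)
     ((p.1 == q.1 + r.1 :> nat)%N && (p.2 == q.2 + r.2 :> nat)%N)%:R * (f q * g r)].

(* Poisson bracket determined by {X,Y} = XY (biderivation):
   {X^i Y^j, X^k Y^l} = (i l - j k) X^(i+k) Y^(j+l). *)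
Definition brL (f g : Lam) : Lam :=
  [ffun p : Bidx => \sum_(q : Bidx) \sum_(r : Bidx)
     ((p.1 == q.1 + r.1 :> nat)%N && (p.2 == q.2 + r.2 :> nat)%N)%:R *
     (((q.1 * r.2)%N%:R - (q.2 * r.1)%N%:R) * (f q * g r))].

(* k-linear maps Lambda^k -> Lambda, given by their values on tuples of
   basis elements. *)
Definition Cochain (k : nat) := {ffun {ffun 'I_k -> Bidx} -> Lam}.

Definition evalC k (P : Cochain k) (fs : seq Lam) : Lam :=
  \sum_(t : {ffun 'I_k -> Bidx})
     (\prod_(m < k) (nth 0 fs m) (t m)) *: P t.

Definition basargs k (t : {ffun 'I_k -> Bidx}) : seq Lam :=
  [seq bas (t m) | m <- enum 'I_k].

Definition dropn (T : Type) (i : nat) (s : seq T) := take i s ++ drop i.+1 s.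

Definition skew_defect k (P : Cochain k) :
  {ffun ({ffun 'I_k -> Bidx} * {perm 'I_k}) -> Lam} :=
  [ffun x : ({ffun 'I_k -> Bidx} * {perm 'I_k}) =>
     P [ffun m => x.1 (x.2 m)] - (-1) ^+ odd_perm x.2 *: P x.1].

Definition der_defect k (P : Cochain k) :
  {ffun ('I_k * {ffun 'I_k -> Bidx} * Bidx * Bidx) -> Lam} :=
  [ffun x : ('I_k * {ffun 'I_k -> Bidx} * Bidx * Bidx) =>
     let: (i, t, u, v) := x in
     let s := basargs t in
     evalC P (set_nth 0 s i (mulL (bas u) (bas v)))
     - mulL (bas u) (evalC P (set_nth 0 s i (bas v)))
     - mulL (bas v) (evalC P (set_nth 0 s i (bas u)))].

Definition chi k : {vspace Cochain k} :=
  (lker (linfun (@skew_defect k)) :&: lker (linfun (@der_defect k)))%VS.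

Definition delta k (P : Cochain k) : Cochain k.+1 :=
  [ffun t => let s := basargs t in
     \sum_(i < k.+1) (-1) ^+ i *: brL (nth 0 s i) (evalC P (dropn i s))
   + \sum_(i < k.+1) \sum_(j < k.+1 | (i < j)%N)
       (-1) ^+ (i + j) *:
         evalC P (brL (nth 0 s i) (nth 0 s j) :: dropn i (dropn j s))].

Definition cocycles k : {vspace Cochain k} :=
  (chi k :&: lker (linfun (@delta k)))%VS.

Definition coboundaries_succ k : {vspace Cochain k.+1} :=
  (linfun (@delta k) @: chi k)%VS.

Definition HP_coh_dim (k : nat) : nat :=
  match k with
  | 0 => \dim (cocycles 0)
  | k'.+1 => \dim (cocycles k'.+1) - \dim (coboundaries_succ k')
  end.

(* {m, X}_{M_nu},  {X^iY^j, X} = -(j-b+1) X^(i+1) Y^j *)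
Definition brMX (m : Lam) : Lam :=
  [ffun p : Bidx => \sum_(q : Bidx)
     ((p.1 == q.1.+1 :> nat) && (p.2 == q.2 :> nat))%:R *
     (- ((q.2)%:R - b%:R + 1) * m q)].

(* {m, Y}_{M_nu},  {X^iY^j, Y} = (i-a+1) X^i Y^(j+1) *)
Definition brMY (m : Lam) : Lam :=
  [ffun p : Bidx => \sum_(q : Bidx)
     ((p.1 == q.1 :> nat) && (p.2 == q.2.+1 :> nat))%:R *
     (((q.1)%:R - a%:R + 1) * m q)].

(* M (x) Omega^0 = M;  M (x) Omega^1 = (M dX + M dY)/R1;
   M (x) Omega^2 = M dX^dY / R2.  An element (mx, my) of Lam * Lam stands
   for mx (x) dX + my (x) dY. *)
Definition R1 : {vspace (Lam * Lam)} :=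
  (limg (linfun (fun m : Lam => (mulL m (mono a.-1 0), 0%R : Lam)))
   + limg (linfun (fun m : Lam => (0%R : Lam, mulL m (mono 0 b.-1)))))%VS.

Definition R2 : {vspace Lam} :=
  (limg (linfun (fun m : Lam => mulL m (mono a.-1 0)))
   + limg (linfun (fun m : Lam => mulL m (mono 0 b.-1))))%VS.

Definition bd1 (c : Lam * Lam) : Lam := brMX c.1 + brMY c.2.

Definition bd2 (m : Lam) : Lam * Lam :=
  (- brMY m - mulL m (mono 0 1), brMX m - mulL m (mono 1 0)).

(* dim HP_k(Lambda(a,b), M_nu): for a quotient complex C_k/R_k, the k-th
   homology is  bd_k^{-1}(R_(k-1)) / (im bd_(k+1) + R_k). *)
Definition HP_hom_dim (k : nat) : nat :=
  match k with
  | 0 => \dim (fullv : {vspace Lam}) - \dim (limg (linfun bd1))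
  | 1 => \dim (linfun bd1 @^-1: (0 : {vspace Lam}))%VS
         - \dim (limg (linfun bd2) + R1)%VS
  | 2 => \dim (linfun bd2 @^-1: R1)%VS - \dim R2
  | _ => 0%N
  end.

End Lambda.

(* Main.v *)
(* Both sides are computed weight by weight. In logarithmic coordinates
   P |-> (P(X)/X, P(Y)/Y) and P |-> P(X,Y)/(XY), the Poisson cochain complex is
   in weight (i,j) a truncation of the Koszul complex of the two scalars i and j;
   the complex computing HP_k(Lambda, M_nu) is likewise a truncated Koszul complex,
   of the scalars b - 1 - j and i - a + 1. Hence the relevant ranks are those of
   subspaces spanned by monomials. The kernels of the logarithmic
   parametrisations of the 1- and 2-cochains are exactly the relation spaces R1 and R2 of the Kaehler differentials, so the
   dimension counts agree on both sides without evaluating dim R1 and dim R2. *)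

(* Dividing by X and Y needs a reason, since both are nilpotent. For a derivation P, the relation
   X^a = 0 gives a X^(a-1) P(X) = 0; in characteristic zero this removes from P(X) every term
   without a factor X. The same holds in each argument of a skew multiderivation. A Koszul strand
   with a nonzero scalar is exact, so homology survives only where both scalars vanish or where
   truncation removes part of the strand. In degree 0 the surviving monomials are 1 and X^(a-1)
   Y^(b-1) on both sides. In degree 2 one class survives on each side: h = 1 for cochains, and
   X^(a-2) Y^(b-2) for chains, where the extra term of the boundary shifts both scalars by one.
   Degree 1 then follows from rank-nullity. As all spaces are finite-dimensional, the isomorphism is
   stated as an equality of dimensions. *)
From HB Require Import structures.
Require Import Defs.
From mathcomp Require Import all_boot all_order all_algebra.
From mathcomp Require Import fingroup perm.
From mathcomp Require Import ring zify.
Set Implicit Arguments. Unset Strict Implicit. Unset Printing Implicit Defensive.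
Import GRing.Theory Num.Theory.
Local Open Scope ring_scope.

(** * Linear algebra preliminaries *)

(** The definitions apply [linfun] to bare functions. It records only the values on a basis, so it
    agrees with [f] once [f] is linear; the proof packs [f] as a linear map on the fly. *)
Lemma linfunE (K : fieldType) (aT rT : vectType K) (f : aT -> rT) :
  linear f -> linfun f =1 f.
Proof.
move=> lf; pose mf := GRing.isLinear.Build _ _ _ _ f lf.
pose g : {linear aT -> rT} := HB.pack f mf.
exact: (lfunE g).
Qed.

(** Rank-nullity for [f] followed by the quotient by [U]: the kernel is the preimage of [U], the
    image is [(limg f + U) / U]. *)
Lemma dim_limg_add (K : fieldType) (aT rT : vectType K) (f : 'Hom(aT, rT))
    (U : {vspace rT}) :
  (\dim (limg f + U) + \dim (f @^-1: U) = \dim {:aT} + \dim U)%N.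
Proof.
rewrite -(limg_ker_dim f fullv) capfv -(limg_ker_dim f (f @^-1: U)).
have -> : (f @^-1: U :&: lker f = lker f)%VS.
  by apply/capv_idPr; rewrite -lpreim0 lpreimS ?sub0v.
have -> : (f @: (f @^-1: U) = limg f :&: U)%VS.
  by rewrite -lpreim_cap_limg lpreimK ?capvSr // capvC.
have := dimv_sum_cap (limg f) U; lia.
Qed.

Lemma ffun_linE (K : pzRingType) (I : finType) (V : lmodType K) (c : K)
  (f g : {ffun I -> V}) x : (c *: f + g) x = c *: f x + g x.
Proof. by rewrite !ffunE. Qed.

(** * Products and brackets with monomials *)

Section LamAlgebra.
Variables (F : numClosedFieldType) (a b : nat).
Local Notation Lam := (Lam F a b).
Local Notation mono := (@mono F a b).
Local Notation bas := (@bas F a b).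
Local Notation T n l := (mulL (mono n l)).
Implicit Types (f g h m : Lam) (p q r u v : Bidx a b) (c : F).

Lemma LamZE c f p : (c *: f) p = c * f p.
Proof. by rewrite ffunE. Qed.

Lemma LamE f : f = \sum_p f p *: bas p.
Proof.
apply/ffunP => p; rewrite sum_ffunE (bigD1 p) //= big1 => [|q qp].
  by rewrite LamZE ffunE !eqxx mulr1 addr0.
rewrite LamZE ffunE; case: eqP => [e1|]; last by rewrite mulr0.
case: eqP => [e2|]; last by rewrite mulr0.
by case/eqP: qp; case: p q e1 e2 => [p1 p2] [q1 q2] /= /val_inj-> /val_inj->.
Qed.

Lemma sum_mono (V : lmodType F) p (u : Bidx a b -> V) :
  \sum_q (bas p q) *: u q = u p.
Proof.
rewrite (bigD1 p) //= ffunE !eqxx scale1r big1 ?addr0 // => q qp.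
rewrite ffunE; case: eqP => [e1|]; last by rewrite scale0r.
case: eqP => [e2|]; last by rewrite scale0r.
by case/eqP: qp; case: p q e1 e2 => [p1 p2] [q1 q2] /= /val_inj-> /val_inj->.
Qed.

Lemma mono_out n l : (a <= n)%N || (b <= l)%N -> mono n l = 0.
Proof.
move=> o; apply/ffunP => -[[p1 lt1] [p2 lt2]]; rewrite !ffunE /=.
by case: eqP => //= e1; case: eqP => //= e2; move: o; lia.
Qed.

Lemma mono_in n l : (n < a)%N -> (l < b)%N ->
  exists p, mono n l = bas p /\ p.1 = n :> nat /\ p.2 = l :> nat.
Proof. by move=> na lb; exists (Ordinal na, Ordinal lb). Qed.

(* Truncated monomials are 0, so this holds with no bound on [n] and [l]. *)
Lemma mulmono n l f p :
  mulL (mono n l) f p =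
  \sum_(r : Bidx a b) ((p.1 == n + r.1 :> nat)%N && (p.2 == l + r.2 :> nat)%N)%:R * f r.
Proof.
rewrite ffunE; have [|] := boolP ((n < a) && (l < b))%N.
  case/andP=> na lb; have [q [-> [<- <-]]] := mono_in na lb.
  rewrite exchange_big /=; apply: eq_bigr => r _.
  rewrite -(sum_mono (V := F^o) q (fun q : Bidx a b =>
    ((p.1 == q.1 + r.1 :> nat)%N && (p.2 == q.2 + r.2 :> nat)%N)%:R * f r)).
  by apply: eq_bigr => s _; rewrite /GRing.scale /=; ring.
rewrite negb_and -!leqNgt => o; rewrite (mono_out o) big1 => [|q _].
  symmetry; apply: big1 => r _; case: p => [[p1 lt1] [p2 lt2]] /=.
  case: eqP => /= [e1|_]; last by rewrite mul0r.
  by case: eqP => /= [e2|_]; [move: o; lia|rewrite mul0r].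
by apply: big1 => r _; rewrite ffunE mul0r mulr0.
Qed.

Lemma mulmono_shift n l f p r :
  p.1 = (n + r.1)%N :> nat -> p.2 = (l + r.2)%N :> nat ->
  mulL (mono n l) f p = f r.
Proof.
move=> e1 e2; rewrite mulmono (bigD1 r) //= e1 e2 !eqxx mul1r big1 ?addr0 //.
move=> q qr; case: eqP => [/addnI d1|]; last by rewrite mul0r.
case: eqP => [/addnI d2|]; last by rewrite mul0r.
by case/eqP: qr; case: r q d1 d2 {e1 e2} => [? ?] [? ?] /= /val_inj-> /val_inj->.
Qed.

Lemma mulmono_out n l f p :
  (p.1 < n)%N || (p.2 < l)%N -> mulL (mono n l) f p = 0.
Proof.
move=> o; rewrite mulmono big1 // => r _.
case: eqP => [d1|]; last by rewrite mul0r.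
by case: eqP => [d2|]; [move: o; lia|rewrite mul0r].
Qed.

(** Multiplication by a monomial is a partial shift of coordinates, and the index [r] does not
    depend on [f]. Identities between such products can thus be checked coordinate by coordinate. *)
Lemma mulmonoP n l p :
  (forall f, mulL (mono n l) f p = 0) \/
  exists r, [/\ p.1 = (n + r.1)%N :> nat, p.2 = (l + r.2)%N :> nat &
    forall f, mulL (mono n l) f p = f r].
Proof.
have [o|] := boolP ((p.1 < n) || (p.2 < l))%N.
  by left => f; apply: mulmono_out.
rewrite negb_or -!leqNgt => /andP[n1 l2]; right.
have lt1 : (p.1 - n < a)%N by rewrite (leq_ltn_trans (leq_subr _ _)).
have lt2 : (p.2 - l < b)%N by rewrite (leq_ltn_trans (leq_subr _ _)).
exists (Ordinal lt1, Ordinal lt2); split=> [||f]; rewrite /= ?subnKC //.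
by apply: mulmono_shift => /=; rewrite subnKC.
Qed.

Lemma mulmono_linear n l : linear (mulL (mono n l)).
Proof.
move=> c f g; apply/ffunP => p; rewrite [RHS]ffunE LamZE.
by have [z|[r [_ _ z]]] := mulmonoP n l p; rewrite !z ?ffunE ?mulr0 ?addr0.
Qed.

Lemma mulLC f g : mulL f g = mulL g f.
Proof.
apply/ffunP => p; rewrite !ffunE exchange_big; apply: eq_bigr => q _.
apply: eq_bigr => r _; by rewrite [(r.1 + _)%N]addnC [(r.2 + _)%N]addnC [f r * _]mulrC.
Qed.

Lemma mulmonoA n l n' l' f :
  mulL (mono n l) (mulL (mono n' l') f) = mulL (mono (n + n') (l + l')) f.
Proof.
apply/ffunP => p; have [z|[r [e1 e2 z]]] := mulmonoP n l p.
  have [z'|[r [e1 e2 z']]] := mulmonoP (n + n') (l + l') p.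
    by rewrite z z'.
  (* The full shift reaches [p], so the intermediate index lies below [p] and is in range. *)
  have na : (n' + r.1 < a)%N by have := ltn_ord p.1; rewrite e1; lia.
  have lb : (l' + r.2 < b)%N by have := ltn_ord p.2; rewrite e2; lia.
  have [q [_ [q1 q2]]] := mono_in na lb.
  have k g : mulL (mono n l) g p = g q by apply: mulmono_shift; lia.
  by rewrite k z' (@mulmono_shift _ _ _ _ r) //; lia.
rewrite z; have [z'|[s [d1 d2 z']]] := mulmonoP n' l' r.
  rewrite z'; have [z''|[s [d1 d2 z'']]] := mulmonoP (n + n') (l + l') p.
    by rewrite z''.
  by rewrite z'' -(z' f); apply: mulmono_shift; lia.
by rewrite z' (@mulmono_shift _ _ _ _ s) //; lia.
Qed.

Lemma mulmonoM n l n' l' : mulL (mono n l) (mono n' l') = mono (n + n') (l + l').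
Proof.
apply/ffunP => p; have [z|[r [e1 e2 z]]] := mulmonoP n l p.
  rewrite z ffunE; have [e1|//] := eqP; have [e2|//] := eqP.
  have na : (n' < a)%N by have := ltn_ord p.1; rewrite e1; lia.
  have lb : (l' < b)%N by have := ltn_ord p.2; rewrite e2; lia.
  have [q [e [q1 q2]]] := mono_in na lb.
  rewrite -(z (bas q)) (@mulmono_shift _ _ _ _ q); try lia.
  by rewrite ffunE !eqxx.
by rewrite z !ffunE e1 e2 !eqn_add2l.
Qed.

(** The Euler operators X d/dX and Y d/dY. They are diagonal on monomials and express the bracket:
    {f, g} = [eulerX f] [eulerY g] - [eulerY f] [eulerX g]. *)
Definition eulerX f : Lam := [ffun p : Bidx a b => (p.1 : nat)%:R * f p].
Definition eulerY f : Lam := [ffun p : Bidx a b => (p.2 : nat)%:R * f p].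

Lemma eulerXE f p : eulerX f p = (p.1 : nat)%:R * f p.
Proof. by rewrite ffunE. Qed.

Lemma eulerYE f p : eulerY f p = (p.2 : nat)%:R * f p.
Proof. by rewrite ffunE. Qed.

Lemma LamDE f g p : (f + g) p = f p + g p.
Proof. by rewrite ffunE. Qed.

Lemma LamNE f p : (- f) p = - f p.
Proof. by rewrite ffunE. Qed.

Lemma Lam0E p : (0 : Lam) p = 0.
Proof. by rewrite ffunE. Qed.

Definition entryE := (Lam0E, LamDE, LamNE, LamZE, eulerXE, eulerYE).

(** Bracketing with X^n Y^l is multiplication by it after n [eulerY] - l [eulerX]; moving these
    operators past X^n' Y^l' adds the constant n l' - l n'. A common monomial can then be factored
    out of all terms of a coboundary. *)
Lemma brmono n l n' l' f :
  brL (mono n l) (mulL (mono n' l') f) =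
  mulL (mono (n + n') (l + l'))
    (((n * l')%:R - (l * n')%:R) *: f + n%:R *: eulerY f - l%:R *: eulerX f).
Proof.
apply/ffunP => p.
have -> g : brL (mono n l) g p = mulL (mono n l) (n%:R *: eulerY g - l%:R *: eulerX g) p.
  rewrite !ffunE; apply: eq_bigr => q _; apply: eq_bigr => r _; rewrite !ffunE.
  have [e1|] := (altP (q.1 =P n :> nat)); last by move=> _; rewrite !(mul0r, mulr0).
  have [e2|] := (altP (q.2 =P l :> nat)); last by move=> _; rewrite !(mul0r, mulr0).
  by rewrite e1 e2 !natrM /GRing.scale /=; ring.
rewrite -mulmonoA; congr (mulL _ _ _); apply/ffunP => q.
rewrite !entryE; have [z|[r [e1 e2 z]]] := mulmonoP n' l' q; rewrite !z.
  by rewrite !mulr0 subr0.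
by rewrite !entryE e1 e2 !natrD !natrM; ring.
Qed.

Lemma basE p q : bas p q = (q == p)%:R.
Proof. by case: p q => p1 p2 [q1 q2]; rewrite ffunE xpair_eqE. Qed.

Lemma mulmonoZ n l c f : T n l (c *: f) = c *: T n l f.
Proof.
apply/ffunP => p; rewrite !entryE; have [z|[r [_ _ z]]] := mulmonoP n l p.
  by rewrite !z mulr0.
by rewrite !z entryE.
Qed.

Lemma mulmonoD n l f g : T n l (f + g) = T n l f + T n l g.
Proof. by have := mulmono_linear n l 1 f g; rewrite !scale1r. Qed.

Lemma mulmono0 n l : T n l 0 = 0.
Proof. by apply: (addrI (T n l 0)); rewrite -mulmonoD !addr0. Qed.

Lemma mulmonoN n l f : T n l (- f) = - T n l f.
Proof. by apply: (addrI (T n l f)); rewrite -mulmonoD !subrr mulmono0. Qed.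

Lemma mulmono_sum n l (I : finType) (f : I -> Lam) :
  T n l (\sum_i f i) = \sum_i T n l (f i).
Proof. by apply: (big_morph _ (mulmonoD n l) (mulmono0 n l)). Qed.

Lemma mulmono_div n l f :
  (forall p, f p != 0 -> (n <= p.1)%N /\ (l <= p.2)%N) ->
  exists g, f = T n l g.
Proof.
move=> fnl; exists (\sum_p f p *: mono (p.1 - n) (p.2 - l)).
rewrite {1}(LamE f) mulmono_sum; apply: eq_bigr => p _.
have [->|/fnl[np lp]] := eqVneq (f p) 0; first by rewrite !scale0r mulmono0.
by rewrite mulmonoZ mulmonoM !subnKC.
Qed.

Lemma mulmono_id f : T 0 0 f = f.
Proof. by apply/ffunP => p; apply: mulmono_shift. Qed.

Lemma brmonoM n l n' l' :
  brL (mono n l) (mono n' l') =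
  ((n * l')%:R - (l * n')%:R) *: mono (n + n') (l + l').
Proof.
have := brmono n l n' l' (mono 0 0); rewrite mulmonoM !addn0 => ->.
have -> : eulerX (mono 0 0) = 0.
  apply/ffunP => p; rewrite !entryE ffunE.
  by case: eqP => [->|]; rewrite ?mul0r ?mulr0.
have -> : eulerY (mono 0 0) = 0.
  apply/ffunP => p; rewrite !entryE ffunE andbC.
  by case: eqP => [->|]; rewrite ?mul0r ?mulr0.
by rewrite !scaler0 subr0 addr0 mulmonoZ mulmonoM !addn0.
Qed.

Hypotheses (a2 : (2 <= a)%N) (b2 : (2 <= b)%N).
Let a0 : (0 < a)%N := ltnW a2.
Let b0 : (0 < b)%N := ltnW b2.

(** * Derivations in logarithmic form *)

Section LogDerivation.
(** [A n l] is the value of a derivation on X^n Y^l. The Leibniz rule is assumed for factors in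
    range, but their product may leave the range, where [A] vanishes: this is how X^a = 0 and Y^b =
    0 constrain the derivation. *)
Variable A : nat -> nat -> Lam.
Hypothesis A_out : forall n l, (a <= n)%N || (b <= l)%N -> A n l = 0.
Hypothesis A_der : forall n l n' l',
  (n < a)%N -> (l < b)%N -> (n' < a)%N -> (l' < b)%N ->
  A (n + n') (l + l') = T n l (A n' l') + T n' l' (A n l).

Lemma der_one : A 0 0 = 0.
Proof.
have := @A_der 0 0 0 0; rewrite !mulmono_id !add0n => /(_ _ _ _ _)/esym.
by move=> e; apply: (addrI (A 0 0)); rewrite addr0 e //; lia.
Qed.

Lemma der_X n : (n < a)%N -> A n.+1 0 = n.+1%:R *: T n 0 (A 1 0).
Proof.
elim: n => [|n IHn] na; first by rewrite mulmono_id scale1r.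
rewrite -(add1n n.+1) (@A_der 1 0 n.+1 0); try lia.
rewrite IHn 1?ltnW // mulmonoZ mulmonoA add1n -[in RHS]natr1 scalerDl scale1r.
by [].
Qed.

Lemma der_Y l : (l < b)%N -> A 0 l.+1 = l.+1%:R *: T 0 l (A 0 1).
Proof.
elim: l => [|l IHl] lb; first by rewrite mulmono_id scale1r.
rewrite -(add1n l.+1) (@A_der 0 1 0 l.+1); try lia.
rewrite IHl 1?ltnW // mulmonoZ mulmonoA add1n -[in RHS]natr1 scalerDl scale1r.
by [].
Qed.

(** [der_X] with n + 1 = a reads 0 = a X^(a-1) [A 1 0]. If [p.1] = 0, the coefficient of [A 1 0] at
    [p] reappears, times a, at X^(a-1) Y^(p.2), and so it is zero. *)
Lemma der_X_div : exists f, A 1 0 = T 1 0 f.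
Proof.
apply: mulmono_div => p; split=> //; rewrite lt0n; apply: contraNneq H => p0.
have la : (a.-1 < a)%N by lia.
have := der_X la; rewrite prednK 1?ltnW // A_out ?leqnn // => /ffunP.
move=> /(_ (Ordinal la, p.2)); rewrite !entryE (@mulmono_shift _ _ _ _ p) /=; try lia.
by move=> /esym/eqP; rewrite mulf_eq0 pnatr_eq0; case/orP=> //; lia.
Qed.

Lemma der_Y_div : exists f, A 0 1 = T 0 1 f.
Proof.
apply: mulmono_div => p; split=> //; rewrite lt0n; apply: contraNneq H => p0.
have lb : (b.-1 < b)%N by lia.
have := der_Y lb; rewrite prednK 1?ltnW // A_out ?leqnn ?orbT // => /ffunP.
move=> /(_ (p.1, Ordinal lb)); rewrite !entryE (@mulmono_shift _ _ _ _ p) /=; try lia.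
by move=> /esym/eqP; rewrite mulf_eq0 pnatr_eq0; case/orP=> //; lia.
Qed.

Lemma der_log f g n l : A 1 0 = T 1 0 f -> A 0 1 = T 0 1 g ->
  (n < a)%N -> (l < b)%N -> A n l = T n l (n%:R *: f + l%:R *: g).
Proof.
move=> Af Ag na lb; have := @A_der n 0 0 l; rewrite addn0 add0n => ->; try lia.
have -> : A n 0 = n%:R *: T n 0 f.
  case: n na => [|n] na; first by rewrite der_one scale0r.
  by rewrite der_X 1?ltnW // Af mulmonoA addn1.
have -> : A 0 l = l%:R *: T 0 l g.
  case: l lb => [|l] lb; first by rewrite der_one scale0r.
  by rewrite der_Y 1?ltnW // Ag mulmonoA addn1.
by rewrite !mulmonoD !mulmonoZ !mulmonoA !addn0 !add0n addrC.
Qed.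

End LogDerivation.

(** * Multiderivations, one argument at a time *)

Section Slots.
Variable k : nat.
Implicit Types (P : Cochain F a b k) (t : {ffun 'I_k -> Bidx a b}) (i : 'I_k).

Definition upd t i p : {ffun 'I_k -> Bidx a b} :=
  [ffun m => if m == i then p else t m].

Lemma upd_id t i : upd t i (t i) = t.
Proof. by apply/ffunP => m; rewrite ffunE; case: eqP => // ->. Qed.

Lemma nth_basargs t (i : 'I_k) : nth 0 (basargs F t) i = bas (t i).
Proof. by rewrite (nth_map i) ?size_enum_ord // nth_ord_enum. Qed.

(** With basis elements in all slots but [i], each index tuple differing from [t] outside [i] has a
    zero factor, so only the expansion in slot [i] is left. *)
Lemma evalC_slot P (fs : seq Lam) t i :
    (forall m : 'I_k, m != i -> nth 0 fs m = bas (t m)) ->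
  evalC P fs = \sum_p (nth 0 fs i) p *: P (upd t i p).
Proof.
move=> fst; rewrite /evalC.
rewrite (partition_big (fun t' : {ffun 'I_k -> Bidx a b} => t' i) xpredT) //=.
apply: eq_bigr => p _; rewrite (bigD1 (upd t i p)) ?ffunE ?eqxx //=.
rewrite (bigD1 i) //= ffunE eqxx big1 ?mulr1 => [|m mi].
  rewrite big1 ?addr0 // => t' /andP[/eqP t'p]; apply: contraNeq => nz.
  apply/eqP/ffunP => m; rewrite ffunE; case: eqVneq => [->//|mi].
  move: nz; apply: contraNeq => t'm; rewrite (bigD1 m) //= fst // basE.
  by rewrite (negPf t'm) mul0r scale0r.
by rewrite ffunE (negPf mi) fst // basE eqxx.
Qed.

(** Extending the value table by zero beyond the truncation lets slot [i] hold a product of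
    monomials with no case split on its exponents. The scalar [c] accommodates brackets of basis
    elements. *)
Lemma evalC_slot_mono P (fs : seq Lam) t i c n l (A : nat -> nat -> Lam) :
    (forall m : 'I_k, m != i -> nth 0 fs m = bas (t m)) ->
    nth 0 fs i = c *: mono n l ->
    (forall r, P (upd t i r) = A r.1 r.2) ->
    (forall n l, (a <= n)%N || (b <= l)%N -> A n l = 0) ->
  evalC P fs = c *: A n l.
Proof.
move=> /evalC_slot-> -> PA A0.
have [|] := boolP ((n < a) && (l < b))%N.
  case/andP=> na lb; have [q [-> [<- <-]]] := mono_in na lb.
  rewrite -PA -(sum_mono q (fun q => P (upd t i q))) scaler_sumr.
  by apply: eq_bigr => r _; rewrite LamZE scalerA.
rewrite negb_and -!leqNgt => o; rewrite A0 // (mono_out o) !scaler0.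
by rewrite big1 // => p _; rewrite Lam0E scale0r.
Qed.

Lemma evalC_linear (fs : seq Lam) : linear (fun P => evalC P fs).
Proof.
move=> c P Q; rewrite /evalC scaler_sumr -big_split; apply: eq_bigr => t _ /=.
by rewrite !ffunE scalerDr !scalerA mulrC.
Qed.

Lemma skew_defect_linear : linear (@skew_defect F a b k).
Proof.
move=> c P Q; apply/ffunP => x; rewrite ffun_linE [LHS]ffunE.
rewrite [skew_defect P x]ffunE [skew_defect Q x]ffunE !ffun_linE.
by rewrite scalerBr scalerDr opprD addrACA !scalerA mulrC.
Qed.

Lemma der_defect_linear : linear (@der_defect F a b k).
Proof.
move=> c P Q; apply/ffunP => -[[[i t] u] v]; rewrite ffun_linE [LHS]ffunE.
rewrite [der_defect P _]ffunE [der_defect Q _]ffunE /= !evalC_linear.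
by rewrite !mulmono_linear !scalerBr !opprD [RHS]addrACA [X in _ = X + _]addrACA.
Qed.

Lemma brL_linear f : linear (brL f).
Proof.
move=> c g h; apply/ffunP => p; rewrite !ffunE /GRing.scale /= mulr_sumr.
rewrite -big_split; apply: eq_bigr => q _ /=; rewrite mulr_sumr -big_split.
by apply: eq_bigr => r _ /=; rewrite !ffunE /GRing.scale /=; ring.
Qed.

Lemma delta_linear : linear (@delta F a b k).
Proof.
move=> c P Q; apply/ffunP => t; rewrite !ffunE /= !scalerDr addrACA.
congr (_ + _); rewrite scaler_sumr -big_split; apply: eq_bigr => i _ /=.
  rewrite evalC_linear brL_linear scalerDr !scalerA; congr (_ *: _ + _); exact: mulrC.
rewrite scaler_sumr -big_split; apply: eq_bigr => j _ /=.
rewrite evalC_linear scalerDr !scalerA; congr (_ *: _ + _); exact: mulrC.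
Qed.

Lemma mulbas u v : mulL (bas u) (bas v) = mono (u.1 + v.1) (u.2 + v.2).
Proof. exact: mulmonoM. Qed.

Lemma nth_slot t i (m : 'I_k) f : m != i ->
  nth 0 (set_nth 0 (basargs F t) i f) m = bas (t m).
Proof. by move=> mi; rewrite nth_set_nth /= val_eqE (negPf mi) nth_basargs. Qed.

Lemma evalC_slot_bas P t i v :
  evalC P (set_nth 0 (basargs F t) i (bas v)) = P (upd t i v).
Proof.
rewrite (@evalC_slot _ _ t i) => [|m]; last exact: nth_slot.
by rewrite nth_set_nth /= eqxx sum_mono.
Qed.

Lemma evalC_slot_out P t i n l : (a <= n)%N || (b <= l)%N ->
  evalC P (set_nth 0 (basargs F t) i (mono n l)) = 0.
Proof.
move=> o; rewrite (@evalC_slot _ _ t i) => [|m]; last exact: nth_slot.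
rewrite nth_set_nth /= eqxx mono_out // big1 // => p _.
by rewrite Lam0E scale0r.
Qed.

Lemma memchi P : reflect
  ((forall t (s : {perm 'I_k}),
      P [ffun m => t (s m)] = (-1) ^+ odd_perm s *: P t) /\
   (forall i t u v,
      evalC P (set_nth 0 (basargs F t) i (mono (u.1 + v.1) (u.2 + v.2))) =
      mulL (bas u) (P (upd t i v)) + mulL (bas v) (P (upd t i u))))
  (P \in chi F a b k).
Proof.
rewrite memv_cap !memv_ker !linfunE; [|exact: der_defect_linear|exact: skew_defect_linear].
apply: (iffP andP) => -[]; [move=> /eqP/ffunP S /eqP/ffunP D|move=> S D]; split.
- by move=> t s; have := S (t, s); rewrite !ffunE => /eqP; rewrite subr_eq0 => /eqP.
- move=> i t u v; have := D (i, t, u, v); rewrite !ffunE /= !evalC_slot_bas mulbas => /eqP.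
  by rewrite -addrA -opprD subr_eq0 => /eqP.
- by apply/eqP/ffunP => -[t s]; rewrite !ffunE S subrr.
- apply/eqP/ffunP => -[[[i t] u] v]; rewrite !ffunE /= !evalC_slot_bas mulbas D.
  by rewrite -addrA -opprD subrr.
Qed.

Definition varX : Bidx a b := (Ordinal a2, Ordinal (ltnW b2)).
Definition varY : Bidx a b := (Ordinal (ltnW a2), Ordinal b2).

Lemma chi_der P t i n l n' l' : P \in chi F a b k ->
  (n < a)%N -> (l < b)%N -> (n' < a)%N -> (l' < b)%N ->
  evalC P (set_nth 0 (basargs F t) i (mono (n + n') (l + l'))) =
  T n l (evalC P (set_nth 0 (basargs F t) i (mono n' l'))) +
  T n' l' (evalC P (set_nth 0 (basargs F t) i (mono n l))).
Proof.
move=> /memchi[_ D] na lb na' lb'.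
have [u [-> [<- <-]]] := mono_in na lb; have [v [-> [<- <-]]] := mono_in na' lb'.
by rewrite D !evalC_slot_bas.
Qed.

Lemma chi_div P t i : P \in chi F a b k ->
  (exists f, P (upd t i varX) = T 1 0 f) /\
  (exists g, P (upd t i varY) = T 0 1 g).
Proof.
move=> Pc; rewrite -!evalC_slot_bas; split.
  apply: (der_X_div (A := fun n l => evalC P (set_nth 0 (basargs F t) i (mono n l)))).
    by move=> n l o; rewrite evalC_slot_out.
  by move=> n l n' l'; apply: chi_der.
apply: (der_Y_div (A := fun n l => evalC P (set_nth 0 (basargs F t) i (mono n l)))).
  by move=> n l o; rewrite evalC_slot_out.
by move=> n l n' l'; apply: chi_der.
Qed.

Lemma chi_log P t i f g p : P \in chi F a b k ->
    P (upd t i varX) = T 1 0 f -> P (upd t i varY) = T 0 1 g ->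
  P (upd t i p) = T p.1 p.2 ((p.1 : nat)%:R *: f + (p.2 : nat)%:R *: g).
Proof.
move=> Pc; rewrite -!evalC_slot_bas => PX PY.
apply: (der_log (A := fun n l => evalC P (set_nth 0 (basargs F t) i (mono n l)))) => //.
by move=> n l n' l'; apply: chi_der.
Qed.

Lemma chi_alt P t (i j : 'I_k) : P \in chi F a b k -> i != j ->
  t i = t j -> P t = 0.
Proof.
move=> /memchi[S _] ij tij; have := S t (tperm i j).
rewrite odd_tperm ij expr1 scaleN1r.
have -> : [ffun m => t (tperm i j m)] = t.
  by apply/ffunP => m; rewrite ffunE; case: tpermP => // ->.
move=> e; apply/ffunP => p; rewrite Lam0E.
have : P t p = - P t p by rewrite {1}e LamNE.
by move=> /eqP; rewrite -addr_eq0 -mulr2n mulrn_eq0 => /eqP.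
Qed.

(** X and Y generate the algebra, so zero logarithmic derivatives in one slot force the value there
    to vanish. *)
Lemma chi_reduce P t i : P \in chi F a b k ->
  P (upd t i varX) = 0 -> P (upd t i varY) = 0 -> P t = 0.
Proof.
move=> Pc PX PY; rewrite -(upd_id t i) (@chi_log _ _ _ 0 0) ?mulmono0 //.
by rewrite !scaler0 addr0 mulmono0.
Qed.

End Slots.

(** * Skew multiderivations by degree, in logarithmic coordinates *)

Lemma chi_large k : (3 <= k)%N -> chi F a b k = 0%VS.
Proof.
case: k => [|[|[|k]]] // _; apply/eqP; rewrite -subv0; apply/subvP => P Pc.
rewrite memv0; apply/eqP/ffunP => t; rewrite [RHS]ffunE.
pose i0 : 'I_k.+3 := inord 0; pose i1 : 'I_k.+3 := inord 1; pose i2 : 'I_k.+3 := inord 2.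
have n01 : i0 != i1 by rewrite -val_eqE /= !inordK.
have n02 : i0 != i2 by rewrite -val_eqE /= !inordK.
have n12 : i1 != i2 by rewrite -val_eqE /= !inordK.
(* Three slots are reduced to the two generators X and Y, so by pigeonhole two of them carry the
   same argument. *)
have H p q r : [|| p == q, p == r | q == r] -> P (upd (upd (upd t i0 p) i1 q) i2 r) = 0.
  case/or3P => /eqP e.
  - apply: (chi_alt Pc n01); rewrite !ffunE eqxx (negPf n01) (negPf n02) (negPf n12).
    by rewrite eqxx.
  - apply: (chi_alt Pc n02); rewrite !ffunE eqxx (negPf n01) (negPf n02).
    by rewrite eqxx.
  - by apply: (chi_alt Pc n12); rewrite !ffunE eqxx (negPf n12) eqxx.
apply: (@chi_reduce _ _ _ i0 Pc); apply: (@chi_reduce _ _ _ i1 Pc);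
  by apply: (@chi_reduce _ _ _ i2 Pc); apply: H; rewrite !eqxx ?orbT.
Qed.

(* [x] stands for the pair (P(X)/X, P(Y)/Y) of logarithmic derivatives, which
   is only determined up to the annihilators of X and Y. *)
Definition logder (x : Lam * Lam) : Cochain F a b 1 :=
  [ffun t : {ffun 'I_1 -> Bidx a b} => let p := t ord0 in
     T p.1 p.2 ((p.1 : nat)%:R *: x.1 + (p.2 : nat)%:R *: x.2)].

(* [h] stands for P(X,Y)/(XY), determined up to the annihilator of XY. *)
Definition logbider h : Cochain F a b 2 :=
  [ffun t : {ffun 'I_2 -> Bidx a b} => let p := t ord0 in let q := t ord_max in
     T (p.1 + q.1) (p.2 + q.2) (((p.1 * q.2)%:R - (p.2 * q.1)%:R) *: h)].

Lemma mulmono_out0 n l f : (a <= n)%N || (b <= l)%N -> T n l f = 0.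
Proof.
move=> o; apply/ffunP => p; rewrite Lam0E mulmono_out //; apply/orP.
by case/orP: o => o; [left|right]; apply: leq_trans o.
Qed.

Lemma logder_linear : linear logder.
Proof.
move=> c x y; apply/ffunP => t; rewrite ffun_linE !ffunE /= -mulmono_linear.
by congr mulL; apply/ffunP => p; rewrite !entryE /GRing.scale /=; ring.
Qed.

Lemma logbider_linear : linear logbider.
Proof.
move=> c x y; apply/ffunP => t; rewrite ffun_linE !ffunE /= -mulmono_linear.
by congr mulL; apply/ffunP => p; rewrite !entryE; ring.
Qed.

Lemma eval_logder x (fs : seq Lam) c n l :
  nth 0 fs 0 = c *: mono n l ->
  evalC (logder x) fs = c *: T n l (n%:R *: x.1 + l%:R *: x.2).
Proof.
move=> fs0; apply: (evalC_slot_mono (t := [ffun _ => varX]) (i := ord0)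
  (A := fun n l => T n l (n%:R *: x.1 + l%:R *: x.2))) => //.
- by move=> m; rewrite (ord1 m).
- by move=> r; rewrite !ffunE eqxx.
- by move=> *; apply: mulmono_out0.
Qed.

Lemma eval_logbider0 h (fs : seq Lam) c n l q :
  nth 0 fs 0 = c *: mono n l -> nth 0 fs 1 = bas q ->
  evalC (logbider h) fs =
    c *: T (n + q.1) (l + q.2) (((n * q.2)%:R - (l * q.1)%:R) *: h).
Proof.
move=> fs0 fs1; apply: (evalC_slot_mono (t := [ffun _ => q]) (i := ord0)
  (A := fun n l => T (n + q.1) (l + q.2) (((n * q.2)%:R - (l * q.1)%:R) *: h))) => //.
- by case=> [[|[|m]] lt] // _; rewrite ffunE.
- by move=> r; rewrite !ffunE.
- by move=> *; apply: mulmono_out0; lia.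
Qed.

Lemma eval_logbider1 h (fs : seq Lam) c n l p :
  nth 0 fs 0 = bas p -> nth 0 fs 1 = c *: mono n l ->
  evalC (logbider h) fs =
    c *: T (p.1 + n) (p.2 + l) (((p.1 * l)%:R - (p.2 * n)%:R) *: h).
Proof.
move=> fs0 fs1; apply: (evalC_slot_mono (t := [ffun _ => p]) (i := ord_max)
  (A := fun n l => T (p.1 + n) (p.2 + l) (((p.1 * l)%:R - (p.2 * n)%:R) *: h))) => //.
- by case=> [[|[|m]] lt] // _; rewrite ffunE.
- by move=> r; rewrite !ffunE.
- by move=> *; apply: mulmono_out0; lia.
Qed.

Lemma logder_chi x : logder x \in chi F a b 1.
Proof.
apply/memchi; split=> [t s|i t u v].
  have -> : s = 1%g by apply/permP => m; rewrite !ord1.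
  rewrite odd_perm1 scale1r; congr (logder x _).
  by apply/ffunP => m; rewrite ffunE perm1.
rewrite (ord1 i) (@eval_logder _ _ 1 (u.1 + v.1) (u.2 + v.2)); last first.
  by rewrite nth_set_nth /= scale1r.
rewrite scale1r !ffunE /= !mulmonoA (addnC v.1) (addnC v.2) -mulmonoD.
by congr mulL; apply/ffunP => p; rewrite !entryE !natrD; ring.
Qed.

(** The coefficient is the determinant of the two exponent vectors: additivity in each gives the
    Leibniz rule, alternation gives skew-symmetry. *)
Lemma logbider_chi h : logbider h \in chi F a b 2.
Proof.
apply/memchi; split=> [t s|i t u v].
  have e2 (m : 'I_2) : m = ord0 \/ m = ord_max.
    by case: m => [[|[|m]] lt] //; [left|right]; apply: val_inj.
  rewrite !ffunE /=; have [s0|s0] := e2 (s ord0).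
    have -> : s = 1%g.
      apply/permP => m; rewrite perm1; have [->//|->] := e2 m.
      have [s1|//] := e2 (s ord_max).
      by have := perm_inj (etrans s0 (esym s1)).
    by rewrite !perm1 odd_perm1 scale1r.
  have -> : s = tperm ord0 ord_max.
    apply/permP => m; have [->|->] := e2 m; first by rewrite tpermL.
    rewrite tpermR; have [//|s1] := e2 (s ord_max).
    by have := perm_inj (etrans s0 (esym s1)).
  rewrite tpermL tpermR odd_tperm /= expr1 scaleN1r.
  rewrite (addnC (t ord_max).1) (addnC (t ord_max).2) -scaleN1r -mulmonoZ.
  by congr mulL; apply/ffunP => p; rewrite !entryE !natrM; ring.
have [ei|ei] : i = ord0 \/ i = ord_max.
    by case: i => [[|[|m]] lt] //; [left|right]; apply: val_inj.
  rewrite ei (@eval_logbider0 _ _ 1 (u.1 + v.1) (u.2 + v.2) (t ord_max)); first last.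
  - exact: (@nth_slot _ t ord0 ord_max).
  - by rewrite nth_set_nth /= scale1r.
  rewrite scale1r !ffunE /= !mulmonoA !addnA (addnC v.1) (addnC v.2) -mulmonoD.
  by congr mulL; apply/ffunP => p; rewrite !entryE !natrM !natrD; ring.
rewrite ei (@eval_logbider1 _ _ 1 (u.1 + v.1) (u.2 + v.2) (t ord0)); first last.
- by rewrite nth_set_nth /= scale1r.
- exact: (@nth_slot _ t ord_max ord0).
rewrite scale1r !ffunE /= !mulmonoA !(addnCA u.1) !(addnCA u.2) !(addnCA v.1).
rewrite !(addnCA v.2) !(addnC v.1 u.1) !(addnC v.2 u.2) -mulmonoD.
by congr mulL; apply/ffunP => p; rewrite !entryE !natrM !natrD; ring.
Qed.

Lemma chi1E P : P \in chi F a b 1 -> exists x, P = logder x.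
Proof.
move=> Pc; pose t : {ffun 'I_1 -> Bidx a b} := [ffun _ => varX].
have [[f PX] [g PY]] := chi_div t ord0 Pc.
exists (f, g); apply/ffunP => s; rewrite ffunE /= -(chi_log (s ord0) Pc PX PY).
by congr (P _); apply/ffunP => m; rewrite !ffunE !ord1.
Qed.

Lemma chi2E P : P \in chi F a b 2 -> exists h, P = logbider h.
Proof.
move=> Pc; pose t p q : {ffun 'I_2 -> Bidx a b} :=
  [ffun m => if m == ord0 then p else q].
have tE (s : {ffun 'I_2 -> Bidx a b}) : s = t (s ord0) (s ord_max).
  apply/ffunP => -[[|[|m]] lt] //; rewrite ffunE /=; congr (s _); exact: val_inj.
have t0 p q r : upd (t p q) ord0 r = t r q.
  by apply/ffunP => m; rewrite !ffunE; case: eqP.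
have t1 p q r : upd (t p q) ord_max r = t p r.
  by apply/ffunP => -[[|[|m]] lt] //; rewrite !ffunE.
have Pt p : P (t p p) = 0 by apply: (@chi_alt _ P (t p p) ord0 ord_max); rewrite ?ffunE.
have PN p q : P (t p q) = - P (t q p).
  have [S _] := memchi _ Pc; have := S (t q p) (tperm ord0 ord_max).
  rewrite odd_tperm /= expr1 scaleN1r => <-; congr (P _).
  apply/ffunP => m; rewrite !ffunE; case: tpermP => [->|->|] //.
  by case: m => [[|[|m]] lt] // m0 m1; [case: m0|case: m1]; apply: val_inj.
(* P(X,Y) is divisible by X through the first slot and by Y through the second; on supports this
   means divisibility by XY. *)
have [h Ph] : exists h, P (t varX varY) = T 1 1 h.
  have [[f ef] _] := chi_div (t varX varY) ord0 Pc.
  have [_ [g eg]] := chi_div (t varX varY) ord_max Pc.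
  rewrite t0 in ef; rewrite t1 in eg; apply: mulmono_div => p nz.
  by split; rewrite lt0n; apply: contraNneq nz => p0;
    [rewrite ef|rewrite eg]; rewrite mulmono_out // p0 ?orbT.
exists h; apply/ffunP => s; rewrite [in LHS](tE s) ffunE /=.
set p := s ord0; set q := s ord_max.
(* P(X,-) has logarithmic derivatives 0 and X h, because P(X,X) = 0. Likewise P(Y,-) below has -Y h
   and 0. *)
have PXq : P (t varX q) = T 1 0 ((q.2 : nat)%:R *: T q.1 q.2 h).
  rewrite -(t1 varX varX) (@chi_log _ _ _ _ 0 (T 1 0 h)) //.
  - by rewrite scaler0 add0r !mulmonoZ !mulmonoA add0n addn0 addn1 add1n.
  - by rewrite t1 Pt mulmono0.
  - by rewrite t1 Ph mulmonoA.
have PYq : P (t varY q) = T 0 1 (- ((q.1 : nat)%:R *: T q.1 q.2 h)).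
  rewrite -(t1 varY varX) (@chi_log _ _ _ _ (- T 0 1 h) 0) //.
  - by rewrite scaler0 addr0 !(mulmonoZ, mulmonoN) !mulmonoA addn0 add0n addn1 add1n scalerN.
  - by rewrite t1 PN Ph mulmonoN mulmonoA.
  - by rewrite t1 Pt mulmono0.
rewrite -(t0 varX) (chi_log p Pc (f := (q.2 : nat)%:R *: T q.1 q.2 h)
  (g := - ((q.1 : nat)%:R *: T q.1 q.2 h))) ?t0 //.
rewrite -mulmonoA; congr mulL; rewrite mulmonoZ.
by apply/ffunP => r; rewrite !entryE !natrM; ring.
Qed.

(** * The Poisson coboundary in logarithmic coordinates *)

Definition cochain0 m : Cochain F a b 0 := [ffun _ => m].

Lemma eval_cochain0 m fs : evalC (cochain0 m) fs = m.
Proof.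
have d : forall m : 'I_0, (fun=> Bidx a b) m by case.
rewrite /evalC (bigD1 [ffun i => d i]) //= big_ord0 scale1r ffunE big1 ?addr0 //.
by move=> t /eqP[]; apply/ffunP => -[].
Qed.

Lemma brbas p m : brL (bas p) m =
  T p.1 p.2 ((p.1 : nat)%:R *: eulerY m - (p.2 : nat)%:R *: eulerX m).
Proof.
have := brmono p.1 p.2 0 0 m; rewrite mulmono_id => ->.
by rewrite !muln0 subrr scale0r add0r !addn0.
Qed.

(** This is the Hamiltonian derivation {-, m}: {X, m} = X [eulerY m] and {Y, m} = -Y [eulerX m]. In
    weight (i,j) it is the first Koszul map. *)
Lemma delta_cochain0 m : delta (cochain0 m) = logder (eulerY m, - eulerX m).
Proof.
apply/ffunP => t; rewrite ffunE /= /basargs !enum_ordSl enum_ord0 /=.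
rewrite !big_ord_recl !big_ord0 big_mkcond big_ord_recl big_ord0 /= !addr0.
by rewrite expr0 scale1r eval_cochain0 brbas ffunE /= scalerN.
Qed.

Lemma delta_logder x : delta (logder x) = logbider (eulerX x.1 + eulerY x.2).
Proof.
apply/ffunP => t; rewrite ffunE /=.
under [X in _ + X]eq_bigr do rewrite big_mkcond.
have -> : basargs F t = [:: bas (t ord0); bas (t ord_max)].
  rewrite /basargs !enum_ordSl enum_ord0 /=; congr [:: _; bas (t _)]; exact: val_inj.
rewrite !big_ord_recl !big_ord0 /dropn /= /bump /= !(addr0, add0r).
rewrite ?add0n ?addn0 !(expr0, expr1).
rewrite [logbider _ t]ffunE /=; set p := t ord0; set q := t ord_max.
rewrite (@eval_logder _ [:: bas q] 1 q.1 q.2) ?scale1r //.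
rewrite (@eval_logder _ [:: bas p] 1 p.1 p.2) ?scale1r //.
rewrite (eval_logder _ (c := (p.1 * q.2)%:R - (p.2 * q.1)%:R) 
  (n := p.1 + q.1) (l := p.2 + q.2)); last exact: brmonoM.
rewrite !brmono (addnC q.1) (addnC q.2) -!mulmonoZ -!mulmonoD.
congr mulL; apply/ffunP => r; rewrite !entryE !natrM !natrD; ring.
Qed.

(** All six terms share the monomial with exponent p + q + r. Their Euler parts cancel by [q,r] p -
    [p,r] q + [p,q] r = 0, the relation between three plane vectors with [.,.] the determinant; the
    constant parts cancel as polynomials in the determinants. *)
Lemma delta_logbider h : delta (logbider h) = 0.
Proof.
apply/ffunP => t; rewrite ffunE [RHS]ffunE /=.
under [X in _ + X]eq_bigr do rewrite big_mkcond.
have [p [q [r ->]]] : exists p q r, basargs F t = [:: bas p; bas q; bas r].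
  by rewrite /basargs !enum_ordSl enum_ord0 /=; do 3 eexists.
rewrite !big_ord_recl !big_ord0 /dropn /= /bump /= !(addr0, add0r) ?add0n ?addn0.
rewrite (@eval_logbider0 _ [:: bas q; bas r] 1 q.1 q.2 r) ?scale1r //.
rewrite (@eval_logbider0 _ [:: bas p; bas r] 1 p.1 p.2 r) ?scale1r //.
rewrite (@eval_logbider0 _ [:: bas p; bas q] 1 p.1 p.2 q) ?scale1r //.
rewrite (@eval_logbider0 _ (brL (bas p) (bas q) :: _)
  ((p.1 * q.2)%:R - (p.2 * q.1)%:R)
  (p.1 + q.1) (p.2 + q.2) r) //; last exact: brmonoM.
rewrite (@eval_logbider0 _ (brL (bas p) (bas r) :: _)
  ((p.1 * r.2)%:R - (p.2 * r.1)%:R)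
  (p.1 + r.1) (p.2 + r.2) q) //; last exact: brmonoM.
rewrite (@eval_logbider0 _ (brL (bas q) (bas r) :: _)
  ((q.1 * r.2)%:R - (q.2 * r.1)%:R)
  (q.1 + r.1) (q.2 + r.2) p) //; last exact: brmonoM.
rewrite !brmono.
have -> : (p.1 + r.1 + q.1 = p.1 + q.1 + r.1)%N by lia.
have -> : (p.2 + r.2 + q.2 = p.2 + q.2 + r.2)%N by lia.
have -> : (q.1 + r.1 + p.1 = p.1 + q.1 + r.1)%N by lia.
have -> : (q.2 + r.2 + p.2 = p.2 + q.2 + r.2)%N by lia.
have -> : (p.1 + (q.1 + r.1) = p.1 + q.1 + r.1)%N by lia.
have -> : (p.2 + (q.2 + r.2) = p.2 + q.2 + r.2)%N by lia.
have -> : (q.1 + (p.1 + r.1) = p.1 + q.1 + r.1)%N by lia.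
have -> : (q.2 + (p.2 + r.2) = p.2 + q.2 + r.2)%N by lia.
have -> : (r.1 + (p.1 + q.1) = p.1 + q.1 + r.1)%N by lia.
have -> : (r.2 + (p.2 + q.2) = p.2 + q.2 + r.2)%N by lia.
rewrite -!mulmonoZ -!mulmonoD.
rewrite -[RHS](mulmono0 (p.1 + q.1 + r.1) (p.2 + q.2 + r.2)).
congr mulL; apply/ffunP => s; rewrite !entryE !natrM !natrD; ring.
Qed.

(** * Subspaces spanned by monomials *)

Lemma mem_coord (S : pred (Bidx a b)) (U : {vspace Lam}) m :
    (forall p, S p -> bas p \in U) ->
  (forall p, ~~ S p -> m p = 0) -> m \in U.
Proof.
move=> SU m0; rewrite (LamE m); apply: memv_suml => p _.
by have [/SU bU|/m0->] := boolP (S p); [apply: memvZ|rewrite scale0r mem0v].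
Qed.

(** Functions on [S], extended by zero, parametrise [U] injectively. This turns the rank
    computations below into counts of monomials. *)
Lemma dim_coord (S : pred (Bidx a b)) (U : {vspace Lam}) :
    (forall m p, m \in U -> ~~ S p -> m p = 0) ->
    (forall p, S p -> bas p \in U) ->
  \dim U = #|[pred p | S p]|.
Proof.
move=> US SU; pose I := {p : Bidx a b | S p}.
pose e (g : {ffun I -> F^o}) : Lam := [ffun p => oapp g 0 (insub p)].
have le : linear e.
  move=> c g h; apply/ffunP => p; rewrite ffun_linE !ffunE.
  by case: insub => [x|] /=; rewrite ?ffun_linE ?scaler0 ?addr0.
have -> : U = limg (linfun e).
  apply/vspaceP => m; apply/idP/memv_imgP => [mU|[g _ ->]].
    exists [ffun x : I => m (val x)]; rewrite ?memvf // linfunE //.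
    apply/ffunP => p; rewrite ffunE; case: insubP => [x _ <-|Sp] /=.
      by rewrite ffunE.
    exact: US.
  apply: mem_coord SU _ => p Sp; rewrite linfunE // ffunE.
  by rewrite insubN.
rewrite limg_dim_eq ?dimvf.
  by rewrite /dim /= muln1 card_sig.
rewrite capfv; apply/eqP; rewrite -subv0; apply/subvP => g.
rewrite memv_ker linfunE // memv0 => /eqP/ffunP g0; apply/eqP/ffunP => x.
by have := g0 (val x); rewrite !ffunE valK.
Qed.

Lemma dim_Lam : \dim {:Lam} = #|{: Bidx a b}|.
Proof.
by rewrite (@dim_coord predT) // => *; apply: memvf.
Qed.

Lemma mem_basZ (U : {vspace Lam}) c p : c != 0 -> c *: bas p \in U -> bas p \in U.
Proof. by move=> c0; rewrite rpredZeq (negPf c0). Qed.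

Lemma pred_lt1 : (a.-1 < a)%N. Proof. by rewrite ltn_predL ltnW. Qed.
Lemma pred_lt2 : (b.-1 < b)%N. Proof. by rewrite ltn_predL ltnW. Qed.
Lemma pred2_lt1 : (a.-2 < a)%N. Proof. by lia. Qed.
Lemma pred2_lt2 : (b.-2 < b)%N. Proof. by lia. Qed.

(** * Annihilators of X, Y and XY, and the relation spaces *)

Definition topX p := p.1 == a.-1 :> nat.
Definition topY p := p.2 == b.-1 :> nat.
Definition top p := topX p || topY p.
Definition origin : Bidx a b := (Ordinal (ltnW a2), Ordinal (ltnW b2)).
Definition corner : Bidx a b := (Ordinal pred_lt1, Ordinal pred_lt2).
Definition subcorner : Bidx a b := (Ordinal pred2_lt1, Ordinal pred2_lt2).

Lemma topX_shift p : ~~ topX p -> exists2 q : Bidx a b,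
  q.1 = (1 + p.1)%N :> nat & q.2 = (0 + p.2)%N :> nat.
Proof.
rewrite /topX => pa; have lt : (1 + p.1 < a)%N by have := ltn_ord p.1; lia.
by exists (Ordinal lt, p.2).
Qed.

Lemma topY_shift p : ~~ topY p -> exists2 q : Bidx a b,
  q.1 = (0 + p.1)%N :> nat & q.2 = (1 + p.2)%N :> nat.
Proof.
rewrite /topY => pb; have lt : (1 + p.2 < b)%N by have := ltn_ord p.2; lia.
by exists (p.1, Ordinal lt).
Qed.

Lemma mulX_eq0 f : T 1 0 f = 0 <-> forall p, ~~ topX p -> f p = 0.
Proof.
split=> [e p /topX_shift[q q1 q2]|f0].
  by rewrite -(mulmono_shift f q1 q2) e Lam0E.
apply/ffunP => q; rewrite Lam0E; have [z|[r [q1 _ ->]]] := mulmonoP 1 0 q; first exact: z.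
by apply: f0; rewrite /topX; have := ltn_ord q.1; rewrite q1; lia.
Qed.

Lemma mulY_eq0 f : T 0 1 f = 0 <-> forall p, ~~ topY p -> f p = 0.
Proof.
split=> [e p /topY_shift[q q1 q2]|f0].
  by rewrite -(mulmono_shift f q1 q2) e Lam0E.
apply/ffunP => q; rewrite Lam0E; have [z|[r [_ q2 ->]]] := mulmonoP 0 1 q; first exact: z.
by apply: f0; rewrite /topY; have := ltn_ord q.2; rewrite q2; lia.
Qed.

Lemma mul_topX f p : ~~ topX p -> T a.-1 0 f p = 0.
Proof.
rewrite /topX => pa; apply: mulmono_out; apply/orP; left.
by have := ltn_ord p.1; lia.
Qed.

Lemma mul_topY f p : ~~ topY p -> T 0 b.-1 f p = 0.
Proof.
rewrite /topY => pb; apply: mulmono_out; apply/orP; right.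
by have := ltn_ord p.2; lia.
Qed.

Lemma div_topX f : (forall p, ~~ topX p -> f p = 0) -> exists g, f = T a.-1 0 g.
Proof.
move=> f0; apply: mulmono_div => p nz; split=> //; rewrite leq_eqVlt eq_sym.
by move: nz; apply: contraNT; rewrite negb_or => /andP[/f0->].
Qed.

Lemma div_topY f : (forall p, ~~ topY p -> f p = 0) -> exists g, f = T 0 b.-1 g.
Proof.
move=> f0; apply: mulmono_div => p nz; split=> //; rewrite leq_eqVlt eq_sym.
by move: nz; apply: contraNT; rewrite negb_or => /andP[/f0->].
Qed.

Let mulr_linear n l : linear (fun m : Lam => mulL m (mono n l)).
Proof. by move=> c f g; rewrite !(mulLC _ (mono n l)) mulmono_linear. Qed.

(** The multiples of X^(a-1) are exactly the annihilator of X, and similarly for Y; so [R1] is the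
    product of the two annihilators. *)
Lemma memR1 (x : Lam * Lam) : (x \in R1 F a b) <->
  (forall p, ~~ topX p -> x.1 p = 0) /\ (forall p, ~~ topY p -> x.2 p = 0).
Proof.
have l1 : linear (fun m : Lam => (mulL m (mono a.-1 0), 0 : Lam)).
  by move=> c f g; rewrite mulr_linear; congr pair; rewrite /= scaler0 addr0.
have l2 : linear (fun m : Lam => (0 : Lam, mulL m (mono 0 b.-1))).
  by move=> c f g; rewrite mulr_linear; congr pair; rewrite /= scaler0 addr0.
split=> [/memv_addP[_ /memv_imgP[f _ ->] [_ /memv_imgP[g _ ->] ->]]|[x1 x2]].
  rewrite !linfunE //= !(mulLC _ (mono _ _)); split=> p pt.
    by rewrite LamDE Lam0E mul_topX // addr0.
  by rewrite LamDE Lam0E mul_topY // addr0.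
have [[f ef] [g eg]] := (div_topX x1, div_topY x2).
apply/memv_addP; exists (x.1, 0); first apply/memv_imgP.
  by exists f; rewrite ?memvf // linfunE // mulLC ef.
exists (0, x.2); first (apply/memv_imgP; exists g; rewrite ?memvf //).
  by rewrite linfunE // mulLC eg.
by case: (x) => u v; congr pair; rewrite /= ?addr0 ?add0r.
Qed.

Lemma R2_out m p : m \in R2 F a b -> ~~ top p -> m p = 0.
Proof.
move=> /memv_addP[_ /memv_imgP[f _ ->] [_ /memv_imgP[g _ ->] ->]].
rewrite !linfunE //= !(mulLC _ (mono _ _)) negb_or => /andP[pX pY].
by rewrite LamDE mul_topX // mul_topY // addr0.
Qed.

Lemma R2_in p : top p -> bas p \in R2 F a b.
Proof.
have B (S : pred (Bidx a b)) : S p -> forall q, ~~ S q -> bas p q = 0.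
  by move=> Sp q; rewrite basE; case: eqP => // ->; rewrite Sp.
case/orP=> /B pt; apply/memv_addP.
  have [f ef] := div_topX pt; exists (bas p); last by exists 0; rewrite ?mem0v ?addr0.
  by apply/memv_imgP; exists f; rewrite ?memvf // linfunE // mulLC.
have [f ef] := div_topY pt; exists 0; rewrite ?mem0v //.
exists (bas p); rewrite ?add0r //.
by apply/memv_imgP; exists f; rewrite ?memvf // linfunE // mulLC.
Qed.

Lemma dim_R2 : \dim (R2 F a b) = #|[pred p | top p]|.
Proof. by apply: dim_coord => [m p|p]; [apply: R2_out|apply: R2_in]. Qed.

Lemma lker_logder : lker (linfun logder) = R1 F a b.
Proof.
apply/vspaceP => x; rewrite memv_ker linfunE; last exact: logder_linear.
apply/eqP/idP => [/ffunP x0|/memR1[x1 x2]].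
  apply/memR1; split; [apply/mulX_eq0|apply/mulY_eq0].
    by have := x0 [ffun _ => varX]; rewrite !ffunE /= scale1r scale0r addr0.
  by have := x0 [ffun _ => varY]; rewrite !ffunE /= scale1r scale0r add0r.
apply/ffunP => t; rewrite !ffunE /=; set p := t ord0.
apply/ffunP => q; rewrite Lam0E.
have [->//|[r [q1 q2 ->]]] := mulmonoP p.1 p.2 q; rewrite !entryE.
(* A zero exponent removes its own term; a positive one, since [q] is in range, keeps [r] off the
   row where that component may be nonzero. *)
have [-> | p1] := eqVneq (p.1 : nat) 0%N.
  rewrite mul0r add0r; have [-> | p2] := eqVneq (p.2 : nat) 0%N; first by rewrite mul0r.
  by rewrite x2 ?mulr0 // /topY; have := ltn_ord q.2; rewrite q2; lia.
rewrite x1 ?mulr0 ?add0r; last by rewrite /topX; have := ltn_ord q.1; rewrite q1; lia.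
have [-> | p2] := eqVneq (p.2 : nat) 0%N; first by rewrite mul0r.
by rewrite x2 ?mulr0 // /topY; have := ltn_ord q.2; rewrite q2; lia.
Qed.

Lemma lker_logbider : lker (linfun logbider) = R2 F a b.
Proof.
apply/vspaceP => h; rewrite memv_ker linfunE; last exact: logbider_linear.
apply/eqP/idP => [/ffunP h0|hR].
  apply: (mem_coord R2_in) => p; rewrite negb_or => /andP[pX pY].
  have := h0 [ffun m => if m == ord0 then varX else varY].
  rewrite !ffunE /= !muln1 muln0 subr0 scale1r -{1}(add0n 1%N) -(mulmonoA 1 0 0 1).
  move=> /mulX_eq0 z; have [q q1 q2] := topY_shift pY.
  by rewrite -(mulmono_shift h q1 q2) z // /topX q1.
apply/ffunP => t; rewrite !ffunE /=; set p := t ord0; set q := t ord_max.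
apply/ffunP => s; rewrite Lam0E.
have [->//|[r [s1 s2 ->]]] := mulmonoP (p.1 + q.1) (p.2 + q.2) s; rewrite !entryE.
have [rt|/(R2_out hR)->] := boolP (top r); last by rewrite mulr0.
(* As [r] is on a top row and p + q + r is in range, [p] and [q] have no X-exponent or no Y-exponent
   at all, so the determinant vanishes. *)
have -> : (p.1 * q.2 = p.2 * q.1)%N; last by rewrite subrr mul0r.
have := ltn_ord s.2; have := ltn_ord s.1; rewrite s1 s2.
by move: rt; rewrite /top /topX /topY; nia.
Qed.

(** * Counting the exceptional monomials *)

Definition ends p := (p == origin) || (p == corner).

(** The right side is the condition met by both complexes in degree 0. Its mixed cases would need a
    - 1 = 0 or b - 1 = 0, leaving only 1 and X^(a-1) Y^(b-1). *)
Lemma endsE p : ends p = ((p.1 == 0 :> nat) || topY p) && ((p.2 == 0 :> nat) || topX p).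
Proof.
case: p => [[p1 lt1] [p2 lt2]].
rewrite /ends /topX /topY !xpair_eqE -!val_eqE /=; lia.
Qed.

Lemma card_ends : #|[pred p | ends p]| = 2%N.
Proof.
have -> : #|[pred p | ends p]| = #|pred2 origin corner| by apply: eq_card.
rewrite card2 xpair_eqE -!val_eqE /=.
by have -> : (0 == a.-1) = false by lia.
Qed.

Lemma card_ends_add : (#|[pred p | ~~ ends p]| + 2 = \dim {:Lam})%N.
Proof.
rewrite dim_Lam -card_ends addnC -(cardC [pred p | ends p]).
by congr addn; apply: eq_card.
Qed.

Lemma card_origin : (#|[pred p | p != origin]| + 1 = \dim {:Lam})%N.
Proof.
rewrite dim_Lam addnC -(cardC (pred1 origin)) card1.
by congr addn; apply: eq_card.
Qed.

Lemma card_top_subcorner :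
  (#|[pred p | top p || (p == subcorner)]| = #|[pred p | top p]| + 1)%N.
Proof.
have -> : #|[pred p | top p || (p == subcorner)]| = #|[predU1 subcorner & [pred p | top p]]|.
  by apply: eq_card => p; rewrite !inE orbC.
rewrite cardU1 addnC inE; congr addn.
by rewrite /top /topX /topY /=; lia.
Qed.

(** * Ranks of the boundary maps with coefficients in M_nu *)

Definition twistX m : Lam := [ffun p : Bidx a b => - ((p.2)%:R - b%:R + 1) * m p].
Definition twistY m : Lam := [ffun p : Bidx a b => ((p.1)%:R - a%:R + 1) * m p].

Lemma twistXE m p : twistX m p = - ((p.2)%:R - b%:R + 1) * m p.
Proof. by rewrite ffunE. Qed.

Lemma twistYE m p : twistY m p = ((p.1)%:R - a%:R + 1) * m p.
Proof. by rewrite ffunE. Qed.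

Lemma brMXE m : brMX m = T 1 0 (twistX m).
Proof.
apply/ffunP => p; rewrite mulmono ffunE; apply: eq_bigr => q _.
by rewrite twistXE add1n add0n.
Qed.

Lemma brMYE m : brMY m = T 0 1 (twistY m).
Proof.
apply/ffunP => p; rewrite mulmono ffunE; apply: eq_bigr => q _.
by rewrite twistYE add1n add0n.
Qed.

Lemma twistX_linear : linear twistX.
Proof. by move=> c f g; apply/ffunP => p; rewrite !(entryE, twistXE); ring. Qed.

Lemma twistY_linear : linear twistY.
Proof. by move=> c f g; apply/ffunP => p; rewrite !(entryE, twistYE); ring. Qed.

Lemma bd1_linear : linear (@bd1 F a b).
Proof.
move=> c x y; rewrite /bd1 !brMXE !brMYE twistX_linear twistY_linear.
by rewrite !mulmono_linear scalerDr addrACA.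
Qed.

Lemma bd2E m : bd2 m = (- T 0 1 (twistY m + m), T 1 0 (twistX m - m)).
Proof.
rewrite /bd2 brMXE brMYE !(mulLC m).
by rewrite !mulmonoD mulmonoN opprD.
Qed.

Lemma bd2_linear : linear (@bd2 F a b).
Proof.
move=> c x y; rewrite !bd2E twistX_linear twistY_linear; congr pair.
  rewrite -!mulmonoN -mulmono_linear; congr mulL.
  by apply/ffunP => p; rewrite !entryE; ring.
rewrite -mulmono_linear; congr mulL.
by apply/ffunP => p; rewrite !entryE; ring.
Qed.

Lemma natr_pred (n : nat) : (0 < n)%N -> (n.-1%:R : F) = n%:R - 1.
Proof. by case: n => // n _; rewrite -natr1 addrK. Qed.

(** The scalar b - 1 - j vanishes only on the row j = b - 1, and i - a + 1 only on i = a - 1.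
    Elsewhere they are invertible in characteristic zero, as [twistX_bas] and [twistY_bas]
    record. *)
Lemma twistX0 p m : topY p -> twistX m p = 0.
Proof.
by move=> /eqP pY; rewrite twistXE pY natr_pred //; ring.
Qed.

Lemma twistY0 p m : topX p -> twistY m p = 0.
Proof.
by move=> /eqP pX; rewrite twistYE pX natr_pred //; ring.
Qed.

Lemma twistX_bas p : ~~ topY p -> exists2 c, c != 0 & twistX (bas p) = c *: bas p.
Proof.
move=> pY; exists (- ((p.2 : nat)%:R - b%:R + 1)).
  have -> : (p.2 : nat)%:R - b%:R + 1 = (p.2 : nat)%:R - b.-1%:R :> F
    by rewrite natr_pred //; ring.
  by rewrite oppr_eq0 subr_eq0 eqr_nat.
apply/ffunP => q; rewrite twistXE LamZE basE.
by case: eqP => [->|]; rewrite ?mulr0.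
Qed.

Lemma twistY_bas p : ~~ topX p -> exists2 c, c != 0 & twistY (bas p) = c *: bas p.
Proof.
move=> pX; exists ((p.1 : nat)%:R - a%:R + 1).
  have -> : (p.1 : nat)%:R - a%:R + 1 = (p.1 : nat)%:R - a.-1%:R :> F
    by rewrite natr_pred //; ring.
  by rewrite subr_eq0 eqr_nat.
apply/ffunP => q; rewrite twistYE LamZE basE.
by case: eqP => [->|]; rewrite ?mulr0.
Qed.

Lemma twist0 : (twistX 0 = 0) * (twistY 0 = 0).
Proof.
by split; apply/ffunP => p; rewrite ?twistXE ?twistYE Lam0E mulr0.
Qed.

Lemma bas_mulX p : (0 < p.1)%N ->
  exists q : Bidx a b, [/\ bas p = T 1 0 (bas q), p.1 = q.1.+1 :> nat & p.2 = q.2].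
Proof.
move=> p1; have lt : (p.1.-1 < a)%N by have := ltn_ord p.1; lia.
exists (Ordinal lt, p.2); split=> //=; last by rewrite prednK.
by rewrite mulmonoM /= add1n prednK.
Qed.

Lemma bas_mulY p : (0 < p.2)%N ->
  exists q : Bidx a b, [/\ bas p = T 0 1 (bas q), p.1 = q.1 & p.2 = q.2.+1 :> nat].
Proof.
move=> p2; have lt : (p.2.-1 < b)%N by have := ltn_ord p.2; lia.
exists (p.1, Ordinal lt); split=> //=; last by rewrite prednK.
by rewrite mulmonoM /= add1n prednK.
Qed.

(** A monomial is reached from the X side when i > 0 and j < b - 1, from the Y side when j > 0 and i
    < a - 1. By [endsE] only two monomials escape both: nothing maps to 1, and the scalars vanish at
    the sources of the corner. *)
Lemma dim_limg_bd1 : (\dim (limg (linfun (@bd1 F a b))) + 2 = \dim {:Lam})%N.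
Proof.
rewrite -card_ends_add (@dim_coord (fun p => ~~ ends p)) //.
  move=> m p /memv_imgP[x _ ->]; rewrite negbK linfunE; last exact: bd1_linear.
  rewrite /bd1 brMXE brMYE LamDE => /orP[] /eqP->.
    by rewrite !mulmono_out ?addr0.
  have -> : T 1 0 (twistX x.1) corner = 0.
    have [->//|[r [_ e2 ->]]] := mulmonoP 1 0 corner.
    by apply: twistX0; apply/eqP; rewrite -[LHS]add0n -e2.
  have -> : T 0 1 (twistY x.2) corner = 0; last by rewrite addr0.
  have [->//|[r [e1 _ ->]]] := mulmonoP 0 1 corner.
  by apply: twistY0; apply/eqP; rewrite -[LHS]add0n -e1.
move=> p; rewrite endsE negb_and !negb_or -!lt0n => pN.
have [/andP[p1 pY]|pN1] := boolP ((0 < p.1)%N && ~~ topY p).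
  have [q [e _ e2]] := bas_mulX p1.
  have [c c0 ec] : exists2 c, c != 0 & twistX (bas q) = c *: bas q.
    by apply: twistX_bas; rewrite /topY -e2.
  apply: (mem_basZ c0); apply/memv_imgP; exists (bas q, 0); rewrite ?memvf //.
  rewrite linfunE; last exact: bd1_linear.
  rewrite /bd1 brMXE brMYE /= ec twist0 mulmono0 addr0 mulmonoZ.
  by rewrite -e.
have [p2 pX] : (0 < p.2)%N /\ ~~ topX p.
  by move: pN pN1; rewrite /topX /topY; case: (p) => [[p1 ?] [p2 ?]] /=; lia.
have [q [e e1 _]] := bas_mulY p2.
have [c c0 ec] : exists2 c, c != 0 & twistY (bas q) = c *: bas q.
  by apply: twistY_bas; rewrite /topX -e1.
apply: (mem_basZ c0); apply/memv_imgP; exists (0, bas q); rewrite ?memvf //.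
rewrite linfunE; last exact: bd1_linear.
rewrite /bd1 brMXE brMYE /= ec twist0 mulmono0 add0r mulmonoZ.
by rewrite -e.
Qed.

Lemma twistY_addE m p : (twistY m + m) p = ((p.1.+2)%:R - a%:R) * m p.
Proof. by rewrite LamDE twistYE -!natr1; ring. Qed.

Lemma twistX_subE m p : (twistX m - m) p = - ((p.2.+2)%:R - b%:R) * m p.
Proof. by rewrite LamDE LamNE twistXE -!natr1; ring. Qed.

(** The term mX dY + mY dX shifts the scalars to i + 2 - a and b - 2 - j. They vanish together only
    at [subcorner], which adds one dimension to [R2]. *)
Lemma dim_preim_bd2 :
  (\dim (linfun (@bd2 F a b) @^-1: R1 F a b) = \dim (R2 F a b) + 1)%N.
Proof.
rewrite dim_R2 -card_top_subcorner; apply: dim_coord => [m p|p pK].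
  rewrite -memv_preim linfunE; last exact: bd2_linear.
  rewrite bd2E => /memR1[/= mX mY]; rewrite negb_or negb_or => /andP[/andP[pX pY] ps].
  have [p1|p1] := eqVneq (p.1.+2) a; last first.
    have [q q1 q2] := topY_shift pY; have /mX : ~~ topX q by rewrite /topX q1.
    rewrite LamNE (mulmono_shift _ q1 q2) twistY_addE => /eqP.
    by rewrite oppr_eq0 mulf_eq0 subr_eq0 eqr_nat (negPf p1) => /eqP.
  have [p2|p2] := eqVneq (p.2.+2) b; last first.
    have [q q1 q2] := topX_shift pX; have /mY : ~~ topY q by rewrite /topY q2.
    rewrite (mulmono_shift _ q1 q2) twistX_subE => /eqP.
    by rewrite mulf_eq0 oppr_eq0 subr_eq0 eqr_nat (negPf p2) => /eqP.
  case/eqP: ps; move: p1 p2; case: (p) => [[p1 ?] [p2 ?]] /= e1 e2.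
  by congr pair; apply: val_inj => /=; lia.
rewrite -memv_preim linfunE; last exact: bd2_linear.
rewrite bd2E; apply/memR1; split=> q qt /=.
  rewrite LamNE; have [->|[r [q1 q2 ->]]] := mulmonoP 0 1 q; first by rewrite oppr0.
  rewrite twistY_addE basE; case: eqP => [rp|]; last by rewrite mulr0 oppr0.
  (* [q] has the same X-exponent as [p], so [topX p] is excluded, and [topY p] would push [q] out of
     range; hence [p] is [subcorner]. The second component below is symmetric. *)
  have -> : r.1.+2 = a; last by rewrite subrr mul0r oppr0.
  have lt2 := ltn_ord q.2; move: qt lt2 pK; rewrite -rp /top /topX /topY q1 q2 add0n.
  by move=> /negPf-> lt2 /orP[|/eqP->] /=; lia.
have [->//|[r [q1 q2 ->]]] := mulmonoP 1 0 q.
rewrite twistX_subE basE; case: eqP => [rp|]; last by rewrite mulr0.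
have -> : r.2.+2 = b; last by rewrite subrr oppr0 mul0r.
have lt1 := ltn_ord q.1; move: qt lt1 pK; rewrite -rp /top /topX /topY q1 q2 add0n.
by move=> /negPf-> lt1 /orP[|/eqP->] /=; lia.
Qed.

(** * Ranks of the Poisson complex *)

Lemma chi0_full : limg (linfun cochain0) = chi F a b 0.
Proof.
apply/vspaceP => P; apply/idP/idP => [_|_].
  by apply/memchi; split=> [t s|[]//]; rewrite (_ : s = 1%g) ?odd_perm1 ?scale1r;
    [congr (P _); apply/ffunP => -[]|apply/permP => -[]].
apply/memv_imgP; exists (P [ffun i => origin]); rewrite ?memvf //.
rewrite linfunE; first by apply/ffunP => t; rewrite ffunE; congr (P _); apply/ffunP => -[].
by move=> c f g; apply/ffunP => t; rewrite ffun_linE !ffunE.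
Qed.

Lemma chi1_limg : limg (linfun logder) = chi F a b 1.
Proof.
apply/vspaceP => P; apply/idP/idP => [/memv_imgP[x _ ->]|/chi1E[x ->]].
  by rewrite linfunE; [apply: logder_chi|apply: logder_linear].
by rewrite -(linfunE logder_linear) memv_img ?memvf.
Qed.

Lemma chi2_limg : limg (linfun logbider) = chi F a b 2.
Proof.
apply/vspaceP => P; apply/idP/idP => [/memv_imgP[x _ ->]|/chi2E[x ->]].
  by rewrite linfunE; [apply: logbider_chi|apply: logbider_linear].
by rewrite -(linfunE logbider_linear) memv_img ?memvf.
Qed.

Lemma cochain0_linear : linear cochain0.
Proof. by move=> c f g; apply/ffunP => t; rewrite ffun_linE !ffunE. Qed.

Lemma dim_chi0 : \dim (chi F a b 0) = \dim {:Lam}.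
Proof.
rewrite -chi0_full limg_dim_eq //; apply/eqP; rewrite -subv0; apply/subvP => m.
rewrite memv_cap memv_ker linfunE; last exact: cochain0_linear.
case/andP=> _ /eqP/ffunP/(_ [ffun i => origin]); rewrite !ffunE => ->.
exact: mem0v.
Qed.

(** The kernel consists of the Casimirs: m is one when its Hamiltonian pair lies in [R1], that is,
    when j m vanishes off the row i = a - 1 and i m off the row j = b - 1. By [endsE] these are
    spanned by 1 and the corner. *)
Lemma dim_coboundaries1 :
  (\dim (coboundaries_succ F a b 0) + 2 = \dim {:Lam})%N.
Proof.
rewrite /coboundaries_succ -chi0_full -limg_comp.
rewrite -(limg_ker_dim (linfun (@delta F a b 0) \o linfun cochain0) fullv).
rewrite addnC capfv; congr addn; rewrite -card_ends; symmetry.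
have kE m : (m \in lker (linfun (@delta F a b 0) \o linfun cochain0)) =
    (logder (eulerY m, - eulerX m) == 0).
  rewrite memv_ker comp_lfunE !linfunE ?delta_cochain0 //.
    exact: cochain0_linear.
  exact: delta_linear.
have {}kE m : m \in lker (linfun (@delta F a b 0) \o linfun cochain0) <->
    (forall p, ~~ topX p -> p.2%:R * m p = 0) /\
    (forall p, ~~ topY p -> - (p.1%:R * m p) = 0).
  rewrite kE -(linfunE logder_linear) -memv_ker lker_logder; split.
    move=> /memR1[/= m1 m2]; split=> p pt; last by have := m2 p pt; rewrite !entryE.
    by have := m1 p pt; rewrite entryE.
  by move=> [m1 m2]; apply/memR1; split=> p pt; rewrite !entryE; auto.
apply: dim_coord => [m p /kE[m1 m2]|p]; rewrite endsE.
  rewrite negb_and !negb_or => /orP[] /andP[p0 pt]; apply/eqP.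
    by have /eqP := m2 p pt; rewrite oppr_eq0 mulf_eq0 pnatr_eq0 (negPf p0).
  by have /eqP := m1 p pt; rewrite mulf_eq0 pnatr_eq0 (negPf p0).
case/andP=> pX pY; apply/kE; split=> q qt; rewrite basE;
  case: eqP => [qp|]; rewrite ?mulr0 ?oppr0 //.
  by move: pY; rewrite -qp (negPf qt) orbF => /eqP->; rewrite mul0r.
by move: pX; rewrite -qp (negPf qt) orbF => /eqP->; rewrite mul0r oppr0.
Qed.

(** The second Koszul map; its scalars i and j vanish together only at [origin]. *)
Definition euler (x : Lam * Lam) : Lam := eulerX x.1 + eulerY x.2.

Lemma euler_linear : linear euler.
Proof.
by move=> c x y; apply/ffunP => p; rewrite /euler /= !entryE; ring.
Qed.

Lemma bas_euler p : p != origin -> bas p \in limg (linfun euler).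
Proof.
move=> p0.
have euX (q : Bidx a b) : eulerX (bas q) = (q.1 : nat)%:R *: bas q.
  by apply/ffunP => r; rewrite !entryE basE; case: eqP => [->|]; rewrite ?mulr0.
have euY (q : Bidx a b) : eulerY (bas q) = (q.2 : nat)%:R *: bas q.
  by apply/ffunP => r; rewrite !entryE basE; case: eqP => [->|]; rewrite ?mulr0.
have eu0 : (eulerX 0 = 0) * (eulerY 0 = 0).
  by split; apply/ffunP => r; rewrite !entryE mulr0.
have [p1|p1] := eqVneq (p.1 : nat) 0%N.
  have p2 : (p.2 : nat)%:R != 0 :> F.
    rewrite pnatr_eq0; apply: contraNneq p0 => p2; apply/eqP.
    by case: p p1 p2 => [[? ?] [? ?]] /= e1 e2; congr pair; apply: val_inj.
  apply: (mem_basZ p2); apply/memv_imgP; exists (0, bas p); rewrite ?memvf //.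
  by rewrite (linfunE euler_linear) /euler eu0 euY add0r.
apply: (@mem_basZ _ (p.1 : nat)%:R); first by rewrite pnatr_eq0.
apply/memv_imgP; exists (bas p, 0); rewrite ?memvf //.
by rewrite (linfunE euler_linear) /euler eu0 euX addr0.
Qed.

Lemma dim_limg_euler : (\dim (limg (linfun euler)) + 1 = \dim {:Lam})%N.
Proof.
rewrite -card_origin; congr addn; apply: dim_coord => [m p|p]; last exact: bas_euler.
move=> /memv_imgP[x _ ->]; rewrite linfunE; last exact: euler_linear.
by rewrite negbK => /eqP->; rewrite !entryE !mul0r addr0.
Qed.

Lemma dim_coboundaries2 :
  (\dim (coboundaries_succ F a b 1) + \dim (R2 F a b) + 1 = \dim {:Lam})%N.
Proof.
rewrite /coboundaries_succ -chi1_limg -limg_comp.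
have -> : (linfun (@delta F a b 1) \o linfun logder = linfun logbider \o linfun euler)%VF.
  apply/lfunP => x; rewrite !comp_lfunE (linfunE logder_linear).
  rewrite (linfunE euler_linear) (linfunE logbider_linear).
  rewrite linfunE; [exact: delta_logder|exact: delta_linear].
rewrite limg_comp -dim_limg_euler -(limg_ker_dim (linfun logbider) (limg _)).
congr (_ + _)%N; rewrite addnC lker_logbider; congr (\dim _ + _)%N.
(* [origin] is not on a top row, so all of [R2] lies in the image of [euler] and is lost under
   [logbider]. *)
apply/esym/capv_idPr/subvP => m mR; apply: (mem_coord bas_euler) => p.
rewrite negbK => /eqP->; apply: R2_out mR _.
by rewrite /top /topX /topY /=; lia.
Qed.

Lemma dim_cocycles0 : \dim (cocycles F a b 0) = 2%N.
Proof.
apply/eqP; rewrite -(eqn_add2r (\dim (coboundaries_succ F a b 0))).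
rewrite (limg_ker_dim (linfun (@delta F a b 0)) (chi F a b 0)).
by rewrite dim_chi0 addnC dim_coboundaries1.
Qed.

Lemma dim_cocycles1 :
  (\dim (cocycles F a b 1) + \dim (coboundaries_succ F a b 1) + \dim (R1 F a b)
   = \dim {:Lam} + \dim {:Lam})%N.
Proof.
rewrite (limg_ker_dim (linfun (@delta F a b 1)) (chi F a b 1)) -chi1_limg.
rewrite -lker_logder addnC -(capfv (lker _)) limg_ker_dim.
by rewrite !dimvf.
Qed.

Lemma dim_cocycles2 :
  (\dim (cocycles F a b 2) + \dim (R2 F a b) = \dim {:Lam})%N.
Proof.
have -> : cocycles F a b 2 = chi F a b 2.
  apply/capv_idPl/subvP => P /chi2E[h ->].
  rewrite memv_ker linfunE; last exact: delta_linear.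
  by rewrite delta_logbider.
by rewrite -chi2_limg -lker_logbider addnC -(capfv (lker _)) limg_ker_dim.
Qed.

Lemma dim_preim0_bd1 :
  (\dim (linfun (@bd1 F a b) @^-1: (0 : {vspace Lam})) + \dim (limg (linfun (@bd1 F a b)))
   = \dim {:Lam} + \dim {:Lam})%N.
Proof. by rewrite lpreim0 -(capfv (lker _)) limg_ker_dim !dimvf. Qed.

(** Both sides are 2 in degree 0, 1 in degree 2 and 0 from degree 3 on. *)
Lemma HP_dim_eq k : HP_coh_dim F a b k = HP_hom_dim F a b k.
Proof.
have c1 := dim_coboundaries1; have c2 := dim_coboundaries2.
have z0 := dim_cocycles0; have z1 := dim_cocycles1; have z2 := dim_cocycles2.
have h1 := dim_limg_bd1; have h2 := dim_preim_bd2; have h0 := dim_preim0_bd1.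
have hr : (\dim (limg (linfun (@bd2 F a b)) + R1 F a b) +
    \dim (linfun (@bd2 F a b) @^-1: R1 F a b) = \dim {:Lam} + \dim (R1 F a b))%N.
  exact: dim_limg_add.
case: k => [|[|[|k]]] /=.
- by lia.
(* With r = dim [R1] and s = dim [R2], both differences equal the integer s + 3 - r, so the
   truncated subtractions agree. *)
- have arith (z e r n c k rb i p s : nat) : (z + e + r = n + n -> e + s + 1 = n ->
    c + 2 = n -> k + rb = n + n -> rb + 2 = n -> i + p = n + r -> p = s + 1 ->
    z - c = k - i)%N by lia.
  exact: arith z1 c2 c1 h0 h1 hr h2.
- by lia.
have -> : cocycles F a b k.+3 = 0%VS by rewrite /cocycles chi_large // cap0v.
by rewrite dimv0.
Qed.

End LamAlgebra.

Theorem theorem2 (F : numClosedFieldType) (a b k : nat) :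
  (2 <= a)%N -> (2 <= b)%N -> HP_coh_dim F a b k = HP_hom_dim F a b k.
Proof. by move=> a2 b2; apply: HP_dim_eq. Qed.
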